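(* Let $D_1$ and $D_2$ be simple digraphs on $n_1$ and $n_2$ vertices, with $D_1$ having $m_1$ arcs, and let $G_1=U(D_1)$ be the underlying graph of $D_1$, with $m_1'$ edges. Then (i) $\displaystyle f_{L(D_1 \overrightarrow{\diamond} D_2)} (\lambda)= \big[f_{L(D_2)}(\lambda-1)\big]^{m_1} \det\left(\lambda I_{n_1}-\big(L(D_1)+n_2D_{\rm out}(D_1)\big)-\frac{n_2}{\lambda-1}\,A(D_1)\right)$, (ii) $\displaystyle f_{L(D_1 \overleftarrow{\diamond} D_2)}(\lambda)= \big[f_{L(D_2)}(\lambda-1)\big]^{m_1} \det\left(\lambda I_{n_1}-\big(L(D_1)+n_2D_{\rm in}(D_1)\big)-\frac{n_2}{\lambda-1}\,A(D_1)^T\right)$, (iii) $\displaystyle f_{L(D_1 \overleftrightarrow{\diamond} D_2)}(\lambda)= \big[f_{L(D_2)}(\lambda-2)\big]^{m_1'}\det\left(\lambda I_{n_1}-\big(L(D_1)+n_2D_{\rm deg}(G_1)\big)-\frac{n_2}{\lambda-2}\,Q(G_1)\right)$.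
   Context: Digraphs are simple. $A(D)$ is the adjacency matrix, $D_{\rm out}(D)$ and $D_{\rm in}(D)$ the diagonal out-degree and in-degree matrices, $L(D)=D_{\rm out}(D)-A(D)$. The underlying graph $U(D)$ has an edge $\{u,v\}$ whenever $uv$ or $vu$ is an arc; for a graph $G$, $D_{\rm deg}(G)$ is the diagonal degree matrix and $Q(G)=D_{\rm deg}(G)+A(G)$. $f_M(\lambda)=\det(\lambda I-M)$. Forward-arc-corona $D_1 \overrightarrow{\diamond} D_2$: one copy of $D_1$ and $m_1$ disjoint copies of $D_2$, one per arc; for each arc $a_k=uv$ and each vertex $w$ of the $k$-th copy of $D_2$ add arcs $uw$ and $wv$. Backward-arc-corona $D_1 \overleftarrow{\diamond} D_2$: same, but add arcs $vw$ and $wu$. Symmetric-arc-corona $D_1 \overleftrightarrow{\diamond} D_2$: one copy of $D_1$ and one copy of $D_2$ per edge of $U(D_1)$; for each edge $\{u,v\}$ and each vertex $w$ of the corresponding copy add arcs $uw,wu,vw,wv$. *)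

(* Defs.v *)
From HB Require Import structures.
From mathcomp Require Import all_boot all_order all_algebra.

Set Implicit Arguments.
Unset Strict Implicit.
Unset Printing Implicit Defensive.

Import GRing.Theory.
Local Open Scope ring_scope.

(* Simple digraphs: no loops and no parallel arcs, but the two arcs uv and vu
   may both be present. *)
Record digraph (V : finType) := Digraph {
  arc :> rel V;
  arc_irr : irreflexive arc }.

Record sgraph (V : finType) := SGraph {
  adj :> rel V;
  adj_sym : symmetric adj;
  adj_irr : irreflexive adj }.

Definition arcs (V : finType) (D : digraph V) : finType :=
  {a : V * V | D a.1 a.2}.

Definition edge_set (V : finType) (G : sgraph V) : {set {set V}} :=
  [set e | [exists u, exists v, G u v && (e == [set u; v])]].

Definition edges (V : finType) (G : sgraph V) : finType :=
  {e : {set V} | e \in edge_set G}.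

Section Underlying.
Variables (V : finType) (D : digraph V).

Definition underlying_rel : rel V := fun u v => D u v || D v u.

Fact underlying_sym : symmetric underlying_rel.
Proof. by move=> u v; rewrite /underlying_rel orbC. Qed.

Fact underlying_irr : irreflexive underlying_rel.
Proof. by move=> u; rewrite /underlying_rel !arc_irr. Qed.

Definition underlying : sgraph V := SGraph underlying_sym underlying_irr.

End Underlying.

(* The vertex set V is enumerated by [enum V]; characteristic polynomials and
   determinants do not depend on the choice of this ordering. *)
Section Matrices.
Variables (F : fieldType) (V : finType).

Definition adjmx (e : rel V) : 'M[F]_#|V| :=
  \matrix_(i, j) (e (enum_val i) (enum_val j))%:R.

Definition vdiagmx (d : V -> nat) : 'M[F]_#|V| :=
  diag_mx (\row_i (d (enum_val i))%:R).

Definition outdeg (D : digraph V) (u : V) : nat := #|[set v | D u v]|.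
Definition indeg (D : digraph V) (u : V) : nat := #|[set v | D v u]|.
Definition deg (G : sgraph V) (u : V) : nat := #|[set v | G u v]|.

Definition outdegmx (D : digraph V) : 'M[F]_#|V| := vdiagmx (outdeg D).
Definition indegmx (D : digraph V) : 'M[F]_#|V| := vdiagmx (indeg D).
Definition degmx (G : sgraph V) : 'M[F]_#|V| := vdiagmx (deg G).

Definition laplacian (D : digraph V) : 'M[F]_#|V| := outdegmx D - adjmx D.

Definition signless_laplacian (G : sgraph V) : 'M[F]_#|V| :=
  degmx G + adjmx G.

End Matrices.

(* In the coronas below, [inr (k, w)] is the vertex w of the copy of D2
   attached to the arc (or edge) k of D1. *)
Section Coronas.
Variables (V1 V2 : finType) (D1 : digraph V1) (D2 : digraph V2).

Definition fwd_corona_rel : rel (V1 + arcs D1 * V2) := fun x y =>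
  match x, y with
  | inl u, inl v => D1 u v
  | inl u, inr (a, _) => u == (val a).1
  | inr (a, _), inl v => v == (val a).2
  | inr (a, w), inr (b, z) => (a == b) && D2 w z
  end.

Fact fwd_corona_irr : irreflexive fwd_corona_rel.
Proof. by case=> [u|[a w]] /=; rewrite arc_irr ?andbF. Qed.

Definition fwd_arc_corona := Digraph fwd_corona_irr.

Definition bwd_corona_rel : rel (V1 + arcs D1 * V2) := fun x y =>
  match x, y with
  | inl u, inl v => D1 u v
  | inl v, inr (a, _) => v == (val a).2
  | inr (a, _), inl u => u == (val a).1
  | inr (a, w), inr (b, z) => (a == b) && D2 w z
  end.

Fact bwd_corona_irr : irreflexive bwd_corona_rel.
Proof. by case=> [u|[a w]] /=; rewrite arc_irr ?andbF. Qed.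

Definition bwd_arc_corona := Digraph bwd_corona_irr.

Definition sym_corona_rel : rel (V1 + edges (underlying D1) * V2) :=
  fun x y =>
  match x, y with
  | inl u, inl v => D1 u v
  | inl u, inr (e, _) => u \in val e
  | inr (e, _), inl u => u \in val e
  | inr (e, w), inr (f, z) => (e == f) && D2 w z
  end.

Fact sym_corona_irr : irreflexive sym_corona_rel.
Proof. by case=> [u|[e w]] /=; rewrite arc_irr ?andbF. Qed.

Definition sym_arc_corona := Digraph sym_corona_irr.

End Coronas.

(* Main.v *)
(* In each corona the diagonal block of [lambda I - L] at the new vertices is a
   direct sum of copies of [(lambda - c) I - L(D2)], where [c] is the number of
   arcs from a new vertex back to [D1]. This block fixes the all-ones vector up
   to the factor [lambda - c], so the lower left block [C] equals
   [Diag * (C / (lambda - c))], and column operations clear it without inverting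
   the diagonal block, which may be singular. The Schur complement obtained
   counts the new vertices [w] with arcs [u -> w -> v]: [n2] for each arc [uv]
   in (i), for each arc [vu] in (ii), and for each edge incident to both [u] and
   [v] in (iii). *)

Require Import Defs.
From HB Require Import structures.
From mathcomp Require Import all_boot all_order all_algebra.
From mathcomp Require Import perm ring.

Set Implicit Arguments.
Unset Strict Implicit.
Unset Printing Implicit Defensive.

Import GRing.Theory.
Local Open Scope ring_scope.

(** * Evaluated characteristic polynomials and block determinants *)

Lemma horner_char_poly (R : comNzRingType) n (A : 'M[R]_n) (x : R) :
  (char_poly A).[x] = \det (x%:M - A).
Proof.
(* Evaluation at [x] is a ring morphism, so it passes through the determinant. *)
rewrite -/(horner_eval x _) /char_poly -det_map_mx; congr (\det _).
apply/matrixP=> i j; rewrite !mxE.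
by rewrite -[LHS]/(('X *+ (i == j) - (A i j)%:P).[x]) !(hornerE, hornerMn).
Qed.

(** [X] stands in for $D^{-1}C$: subtracting the second block column times [X] from the first clears
    the lower left block, which is the unipotent factor below. *)
Lemma det_block_schur (R : comNzRingType) m n (A : 'M[R]_m) (B : 'M_(m, n))
    (D : 'M_n) (X : 'M_(n, m)) :
  \det (block_mx A B (D *m X) D) = \det (A - B *m X) * \det D.
Proof.
have -> : block_mx A B (D *m X) D =
    block_mx (A - B *m X) B 0 D *m block_mx 1%:M 0 X 1%:M.
  by rewrite mulmx_block !mulmx0 !mulmx1 !add0r subrK.
by rewrite det_mulmx det_ublock det_lblock !det1 !mulr1.
Qed.

(** * Determinants indexed by finite types *)

Section FunctionDeterminant.
Variable R : comNzRingType.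

(** Indexing by [T] itself lets determinants be transported along bijections and split over sum
    types without casts between matrix sizes. *)
Definition fdet (T : finType) (M : T -> T -> R) : R :=
  \det (\matrix_(i < #|T|, j < #|T|) M (enum_val i) (enum_val j)).

Lemma eq_fdet (T : finType) (M N : T -> T -> R) : M =2 N -> fdet M = fdet N.
Proof. by move=> eqMN; congr (\det _); apply/matrixP=> i j; rewrite !mxE. Qed.

(** Two enumerations of [T] differ by a permutation, and conjugating by its matrix contributes the
    square of a sign. *)
Lemma fdet_ord (T : finType) n (f : 'I_n -> T) (M : T -> T -> R) :
  bijective f -> fdet M = \det (\matrix_(i, j) M (f i) (f j)).
Proof.
move=> bij_f; have eq_n : #|T| = n by rewrite -(bij_eq_card bij_f) card_ord.
case: n / eq_n f bij_f => f bij_f.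
have inj_h : injective (enum_rank \o f).
  exact: inj_comp enum_rank_inj (bij_inj bij_f).
have -> : \matrix_(i, j) M (f i) (f j) =
  perm_mx (perm inj_h) *m (\matrix_(i, j) M (enum_val i) (enum_val j))
    *m (perm_mx (perm inj_h))^T.
  rewrite tr_perm_mx -row_permE -col_permE.
  by apply/matrixP=> i j; rewrite !mxE !permE /= !enum_rankK.
by rewrite !det_mulmx det_tr mulrAC det_perm -signr_addb addbb mul1r.
Qed.

Lemma fdet_bij (S T : finType) (h : S -> T) (M : T -> T -> R) :
  bijective h -> fdet M = fdet (fun x y => M (h x) (h y)).
Proof.
by move=> bij_h; rewrite (fdet_ord M (bij_comp bij_h (enum_val_bij S))).
Qed.

Lemma fdet_sum (S T : finType) (M : S + T -> S + T -> R) :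
  fdet M = \det (block_mx
    (\matrix_(i < #|S|, j < #|S|) M (inl (enum_val i)) (inl (enum_val j)))
    (\matrix_(i < #|S|, j < #|T|) M (inl (enum_val i)) (inr (enum_val j)))
    (\matrix_(i < #|T|, j < #|S|) M (inr (enum_val i)) (inl (enum_val j)))
    (\matrix_(i < #|T|, j < #|T|) M (inr (enum_val i)) (inr (enum_val j)))).
Proof.
pose f (i : 'I_(#|S| + #|T|)) : S + T := match split i with
  | inl i => inl (enum_val i) | inr i => inr (enum_val i) end.
rewrite (@fdet_ord _ _ f).
  congr (\det _); apply/matrixP=> i j.
  rewrite mxE -[i in RHS](splitK i) -[j in RHS](splitK j) /f.
  by case: (split i) => i'; case: (split j) => j';
    rewrite ?(block_mxEul, block_mxEur, block_mxEdl, block_mxEdr) mxE.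
exists (fun x => unsplit (match x with
  | inl s => inl (enum_rank s) | inr t => inr (enum_rank t) end)).
- by move=> i; rewrite -[RHS]splitK /f; case: split => i';
    rewrite enum_valK.
- by case=> x; rewrite /f unsplitK enum_rankK.
Qed.

(** Induction on the number of blocks, once [K] is replaced by an ordinal type. *)
Lemma fdet_diag_blocks (K T : finType) (M : T -> T -> R) :
  fdet (fun x y : K * T => M x.2 y.2 *+ (x.1 == y.1)) = fdet M ^+ #|K|.
Proof.
pose h (x : 'I_#|K| * T) : K * T := (enum_val x.1, x.2).
have bij_h : bijective h.
  exists (fun x => (enum_rank x.1, x.2)) => -[k t].
    by rewrite /h /= enum_valK.
  by rewrite /h /= enum_rankK.
rewrite (fdet_bij _ bij_h).
transitivity (fdet (fun x y : 'I_#|K| * T => M x.2 y.2 *+ (x.1 == y.1))).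
  by apply: eq_fdet => x y; rewrite (inj_eq enum_val_inj).
elim: #|K| {h bij_h} => [|n IHn].
  (* With no blocks the index type is empty, so it is enumerated by the empty function on ['I_0]. *)
  rewrite expr0 (@fdet_ord _ 0 (fun i => (i, False_rect T (notF (valP i))))).
    exact: det_mx00.
  by exists fst => [[]|[[]]].
(* [g] separates block [ord0] from the remaining [n] blocks. *)
pose g (x : T + 'I_n * T) : 'I_n.+1 * T := match x with
  | inl t => (ord0, t) | inr (i, t) => (lift ord0 i, t) end.
have bij_g : bijective g.
  exists (fun x => if unlift ord0 x.1 is Some i then inr (i, x.2)
                   else inl x.2).
    by case=> [t|[i t]] /=; rewrite ?unlift_none ?liftK.
  by case=> i t /=; case: unliftP => [j ->|->].
rewrite (fdet_bij _ bij_g) fdet_sum exprS -IHn.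
set C := (X in block_mx _ _ X).
have -> : C = 0 by apply/matrixP=> i j; rewrite !mxE /g; case: enum_val.
rewrite det_ublock; congr (_ * _); congr (\det _); apply/matrixP=> i j.
by rewrite !mxE /g; case: enum_val => k t; case: enum_val => l u /=;
  rewrite (inj_eq lift_inj).
Qed.

End FunctionDeterminant.

Lemma card_set_sum (T : finType) (P : pred T) :
  #|[set x | P x]| = (\sum_x P x)%N.
Proof. by rewrite -sum1dep_card big_mkcond; apply: eq_bigr => x _; case: P. Qed.

(** * The Laplacian characteristic polynomial of a general corona *)

Section CharacteristicPolynomial.
Variable F : fieldType.

(** The entry of $xI - L = xI - D_{\rm out} + A$, hence the plus sign before the adjacency term. *)
Definition lap_char_entry (V : finType) (D : digraph V) (x : F) (u v : V) : F :=
  (x - (outdeg D u)%:R) *+ (u == v) + (D u v)%:R.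

Lemma char_poly_laplacianE (V : finType) (D : digraph V) (x : F) :
  (char_poly (laplacian F D)).[x] = fdet (lap_char_entry D x).
Proof.
rewrite horner_char_poly; congr (\det _); apply/matrixP=> i j.
rewrite !mxE /lap_char_entry (inj_eq enum_val_inj).
by rewrite opprB addrA addrAC mulrnBl.
Qed.

(** The rows of $L$ sum to zero, so the all-ones vector is an eigenvector of $xI - L$ with
    eigenvalue $x$. *)
Lemma sum_lap_char_entry (V : finType) (D : digraph V) (x : F) (u : V) :
  \sum_v lap_char_entry D x u v = x.
Proof.
rewrite big_split /= -natr_sum -card_set_sum sumrMnr (bigD1 u) //= eqxx.
by rewrite big1 ?addn0 ?mulr1n ?subrK // => v; rewrite eq_sym => /negPf->.
Qed.

Section Corona.
(** A common model of the three coronas. [K] indexes the copies of [D2]; [p u k] says that [u] has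
    arcs to all of copy [k], and [q v k] that all of copy [k] has arcs to [v]. [N u v] counts the
    copies leading from [u] to [v]. *)
Variables (V1 V2 K : finType) (D1 : digraph V1) (D2 : digraph V2).
Variables (p q : V1 -> pred K) (d : V1 -> nat) (N : V1 -> V1 -> nat).
Variables (c : nat) (E : digraph (V1 + K * V2)%type).
Hypothesis E_ll : forall u v, E (inl u) (inl v) = D1 u v.
Hypothesis E_lr : forall u a, E (inl u) (inr a) = p u a.1.
Hypothesis E_rl : forall a v, E (inr a) (inl v) = q v a.1.
Hypothesis E_rr : forall a b, E (inr a) (inr b) = (a.1 == b.1) && D2 a.2 b.2.
Hypothesis card_p : forall u, #|[set k | p u k]| = d u.
Hypothesis card_pq : forall u v, #|[set k | p u k && q v k]| = N u v.
Hypothesis card_q : forall k, #|[set v | q v k]| = c.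

Lemma outdeg_corona_l u :
  outdeg E (inl u) = (outdeg D1 u + d u * #|V2|)%N.
Proof.
rewrite -card_p /outdeg !card_set_sum big_sumType /=; congr (_ + _)%N.
  by apply: eq_bigr => v _; rewrite E_ll.
under eq_bigr do rewrite E_lr.
rewrite -(pair_bigA _ (fun k (w : V2) => p u k : nat)) big_distrl /=.
by apply: eq_bigr => k _; rewrite sum_nat_const mulnC.
Qed.

Lemma outdeg_corona_r a : outdeg E (inr a) = (c + outdeg D2 a.2)%N.
Proof.
rewrite /outdeg -(card_q a.1) !card_set_sum big_sumType /=; congr (_ + _)%N.
  by apply: eq_bigr => v _; rewrite E_rl.
under eq_bigr do rewrite E_rr.
rewrite -(pair_bigA _ (fun k w => (a.1 == k) && D2 a.2 w : nat)) /=.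
rewrite (bigD1 a.1) //= [X in (_ + X)%N]big1 ?addn0 => [|k ne_k].
  by apply: eq_bigr => w _; rewrite eqxx.
by rewrite big1 // => w _; rewrite eq_sym (negPf ne_k).
Qed.

(** The [c] arcs back to [D1] raise each out-degree in a copy by [c], which amounts to shifting
    [x]. *)
Lemma lap_char_entry_corona_rr x a b :
  lap_char_entry E x (inr a) (inr b) =
  lap_char_entry D2 (x - c%:R) a.2 b.2 *+ (a.1 == b.1).
Proof.
rewrite /lap_char_entry outdeg_corona_r E_rr natrD opprD addrA.
case: a b => [k w] [l z] /=; rewrite (inj_eq (@inr_inj _ _)) xpair_eqE.
by case: eqP => _; rewrite ?mulr1n // mulr0n addr0.
Qed.

(** In the Schur complement, the term in [d] comes from the extra out-degrees of old vertices, and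
    the term in [N] from the two-step paths through new vertices. *)
Lemma char_poly_laplacian_corona x : x != c%:R ->
  (char_poly (laplacian F E)).[x] =
  (char_poly (laplacian F D2)).[x - c%:R] ^+ #|K| *
  \det (x%:M - (laplacian F D1 + #|V2|%:R *: vdiagmx F d)
        - (#|V2|%:R / (x - c%:R)) *:
          \matrix_(i, j) (N (enum_val i) (enum_val j))%:R).
Proof.
rewrite -subr_eq0 => mu_neq0; rewrite !char_poly_laplacianE fdet_sum.
set A := (X in block_mx X); set B := (X in block_mx _ X).
set C := (X in block_mx _ _ X); set D := (X in block_mx _ _ _ X).
(* An entry of [C] depends only on the copy of its row, so [D] multiplies it by a row sum of
   [lap_char_entry D2], namely [x - c%:R]. *)
have EC : C = D *m ((x - c%:R)^-1 *: C).
  apply/matrixP=> i j; rewrite -scalemxAr !mxE.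
  under eq_bigr do
    rewrite !mxE lap_char_entry_corona_rr /lap_char_entry E_rl /= mulr0n add0r.
  rewrite -(big_enum_val (A := predT) (fun b : K * V2 =>
    lap_char_entry D2 (x - c%:R) (enum_val i).2 b.2 *+ ((enum_val i).1 == b.1)
      * (q (enum_val j) b.1)%:R)) /=.
  rewrite -(pair_bigA _ (fun k w =>
    lap_char_entry D2 (x - c%:R) (enum_val i).2 w *+ ((enum_val i).1 == k)
      * (q (enum_val j) k)%:R)) /=.
  (* Only the copy containing the row vertex contributes. *)
  rewrite (bigD1 (enum_val i).1) //= [X in _ * (_ + X)]big1 => [|k ne_k]; last first.
    by rewrite big1 // => w _; rewrite eq_sym (negPf ne_k) mulr0n mul0r.
  rewrite eqxx -mulr_suml sum_lap_char_entry addr0 mulKf //.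
  by rewrite /lap_char_entry E_rl /= mulr0n add0r.
rewrite EC det_block_schur mulrC; congr (_ * _).
  rewrite -fdet_diag_blocks; apply: (eq_fdet (M := fun a b =>
    lap_char_entry E x (inr a) (inr b))) => a b.
  exact: lap_char_entry_corona_rr.
congr (\det _); apply/matrixP=> i j; rewrite -scalemxAr !mxE.
congr (_ - _).
  rewrite /lap_char_entry outdeg_corona_l E_ll natrD natrM.
  rewrite (inj_eq (@inl_inj _ _)) (inj_eq enum_val_inj).
  case: (i == j); rewrite ?mulr1n ?mulr0n; ring.
(* Each copy counted by [N] provides [#|V2|] intermediate vertices. *)
under eq_bigr do rewrite !mxE /lap_char_entry E_lr E_rl /= !mulr0n !add0r.
rewrite -(big_enum_val (A := predT) (fun b : K * V2 =>
  (p (enum_val i) b.1)%:R * (q (enum_val j) b.1)%:R)) /=.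
rewrite -(pair_bigA _ (fun k (w : V2) =>
  (p (enum_val i) k)%:R * (q (enum_val j) k)%:R)) /=.
rewrite [#|V2|%:R / _]mulrC -mulrA; congr (_ * _).
rewrite -card_pq card_set_sum natr_sum big_distrr /=; apply: eq_bigr => k _.
by rewrite -natrM mulnb sumr_const mulr_natl.
Qed.

End Corona.

End CharacteristicPolynomial.

(** * Counting arcs and edges at given vertices *)

Section Incidence.

Lemma card_set_sig (T : finType) (P Q : pred T) :
  #|[set x : {x | P x} | Q (val x)]| = #|[set x | P x && Q x]|.
Proof.
rewrite -(card_imset _ val_inj); apply: eq_card => x; rewrite inE.
apply/imsetP/andP => [[y]|[Px Qx]].
  by rewrite inE => Qy ->; rewrite (valP y).
by exists (Sub x Px); rewrite ?inE SubK.
Qed.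

Lemma card_arcs_out (V : finType) (D : digraph V) (u : V) :
  #|[set a : arcs D | u == (val a).1]| = outdeg D u.
Proof.
rewrite (card_set_sig (fun a : V * V => D a.1 a.2) (fun a => u == a.1)).
have inj_pair : injective (fun v : V => (u, v)) by move=> v w [].
rewrite /outdeg -(card_imset _ inj_pair); apply: eq_card => -[x y].
rewrite inE /=; apply/andP/imsetP => [[Dxy /eqP->]|[v + [-> ->]]].
  by exists y; rewrite ?inE.
by rewrite inE.
Qed.

Lemma card_arcs_in (V : finType) (D : digraph V) (v : V) :
  #|[set a : arcs D | v == (val a).2]| = indeg D v.
Proof.
rewrite (card_set_sig (fun a : V * V => D a.1 a.2) (fun a => v == a.2)).
have inj_pair : injective (fun u : V => (u, v)) by move=> u w [].
rewrite /indeg -(card_imset _ inj_pair); apply: eq_card => -[x y].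
rewrite inE /=; apply/andP/imsetP => [[Dxy /eqP->]|[u + [-> ->]]].
  by exists x; rewrite ?inE.
by rewrite inE.
Qed.

(** An arc is determined by its ordered pair of ends, so counting the copies between two vertices
    recovers $A(D)$. *)
Lemma card_arcs_between (V : finType) (D : digraph V) (u v : V) :
  #|[set a : arcs D | (u == (val a).1) && (v == (val a).2)]| = D u v.
Proof.
rewrite (card_set_sig (fun a : V * V => D a.1 a.2)
           (fun a => (u == a.1) && (v == a.2))).
have [Duv|nDuv] := boolP (D u v).
  rewrite /= -(cards1 (u, v)); apply: eq_card => -[x y]; rewrite !inE /=.
  rewrite xpair_eqE (eq_sym x) (eq_sym y) andb_idl //.
  by case/andP=> /eqP<- /eqP<-.
apply/eqP; rewrite cards_eq0; apply/eqP/setP=> -[x y]; rewrite !inE /=.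
by apply/and3P => -[Dxy /eqP eu /eqP ev]; rewrite eu ev Dxy in nDuv.
Qed.

Variables (V : finType) (G : sgraph V).

(** Puts the given end [u] first in the unordered pair, so that the symmetric case is settled once
    for both edge counts below. *)
Lemma edge_atP (u : V) (e : {set V}) :
  reflect (exists2 v, G u v & e = [set u; v]) ((e \in edge_set G) && (u \in e)).
Proof.
apply: (iffP andP) => [[]|[v Guv ->]]; last first.
  rewrite !inE eqxx; split=> //; apply/existsP; exists u.
  by apply/existsP; exists v; rewrite Guv eqxx.
rewrite inE => /existsP[x /existsP[y /andP[Gxy /eqP->]]].
rewrite !inE => /orP[] /eqP->; first by exists y.
by exists x; [rewrite adj_sym | rewrite setUC].
Qed.

(** The ends differ by irreflexivity; this is the constant 2 of the symmetric corona. *)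
Lemma card_edge (e : edges G) : #|val e| = 2%N.
Proof.
have := valP e; rewrite inE => /existsP[x /existsP[y /andP[Gxy /eqP->]]].
by rewrite cards2; case: eqP Gxy => // ->; rewrite adj_irr.
Qed.

(** Sending a neighbour [v] to [[set u; v]] is injective because [v] differs from [u]. *)
Lemma card_edges_at (u : V) : #|[set e : edges G | u \in val e]| = deg G u.
Proof.
rewrite (card_set_sig (fun e => e \in edge_set G) (fun e => u \in e)).
have inj_pair : {in [set v | G u v] &, injective (fun v => [set u; v])}.
  move=> v w; rewrite !inE => Guv Guw /setP/(_ v).
  rewrite !inE eqxx orbT; case: eqP Guv => [->|_ _ /esym/eqP //].
  by rewrite adj_irr.
rewrite /deg -(card_in_imset inj_pair); apply: eq_card => e; rewrite inE.
apply/edge_atP/imsetP => [[v Guv ->]|[v + ->]]; first by exists v; rewrite ?inE.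
by rewrite inE => Guv; exists v.
Qed.

(** These are the entries of $Q(G)$, the vertex-edge incidence matrix times its transpose. Distinct
    vertices can share only the edge [[set u; v]]. *)
Lemma card_edges_between (u v : V) :
  #|[set e : edges G | (u \in val e) && (v \in val e)]| =
  (deg G u * (u == v) + G u v)%N.
Proof.
case: eqP => [<-|/eqP ne_uv].
  rewrite adj_irr muln1 addn0 -card_edges_at; apply: eq_card => e.
  by rewrite !inE andbb.
rewrite (card_set_sig (fun e => e \in edge_set G)
           (fun e => (u \in e) && (v \in e))) muln0 add0n.
have edgeE e : (e \in [set e | (e \in edge_set G) && ((u \in e) && (v \in e))])
    = G u v && (e == [set u; v]).
  rewrite inE andbA; apply/andP/andP => [[/edge_atP[w Guw ->]]|[Guv /eqP->]].
    by rewrite !inE eq_sym (negPf ne_uv) => /eqP->.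
  by split; [apply/edge_atP; exists v | rewrite !inE eqxx orbT].
rewrite (eq_card edgeE); case: (G u v); last exact: eq_card0.
by rewrite /= -(cards1 [set u; v]); apply: eq_card => e; rewrite !inE.
Qed.

End Incidence.

(** * The three coronas as instances of the general one *)

Theorem theorem4p8 (F : fieldType) (V1 V2 : finType)
    (D1 : digraph V1) (D2 : digraph V2) (n2 m1 m1' : nat)
    (hn2 : #|V2| = n2) (hm1 : #|arcs D1| = m1)
    (hm1' : #|edges (underlying D1)| = m1') (lambda : F) :
  [/\ lambda != 1 ->
      (char_poly (laplacian F (fwd_arc_corona D1 D2))).[lambda] =
      (char_poly (laplacian F D2)).[lambda - 1] ^+ m1 *
      \det (lambda%:M - (laplacian F D1 + n2%:R *: outdegmx F D1)
            - (n2%:R / (lambda - 1)) *: adjmx F D1),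
      lambda != 1 ->
      (char_poly (laplacian F (bwd_arc_corona D1 D2))).[lambda] =
      (char_poly (laplacian F D2)).[lambda - 1] ^+ m1 *
      \det (lambda%:M - (laplacian F D1 + n2%:R *: indegmx F D1)
            - (n2%:R / (lambda - 1)) *: (adjmx F D1)^T)
    & lambda != 2%:R ->
      (char_poly (laplacian F (sym_arc_corona D1 D2))).[lambda] =
      (char_poly (laplacian F D2)).[lambda - 2%:R] ^+ m1' *
      \det (lambda%:M - (laplacian F D1 + n2%:R *: degmx F (underlying D1))
            - (n2%:R / (lambda - 2%:R)) *: signless_laplacian F (underlying D1))].
Proof.
rewrite -hn2 -hm1 -hm1'; split=> ne_lambda.
- rewrite -[lambda - 1]/(lambda - 1%:R).
  apply: (char_poly_laplacian_corona (K := arcs D1) (D1 := D1)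
    (D2 := D2) (E := fwd_arc_corona D1 D2) (d := outdeg D1)
    (N := fun u v => nat_of_bool (D1 u v)) (p := fun u a => u == (val a).1)
    (q := fun v a => v == (val a).2) (c := 1)) => //.
  + by move=> u [].
  + by case.
  + by case=> [a w] [].
  + exact: card_arcs_out.
  + exact: card_arcs_between.
  + by move=> a; rewrite cardsE card1.
(* Reversing the added arcs exchanges [p] and [q], so [N] becomes the transposed adjacency
   relation. *)
- have -> : (adjmx F D1)^T =
      \matrix_(i, j) (D1 (enum_val j) (enum_val i))%:R.
    by apply/matrixP=> i j; rewrite !mxE.
  rewrite -[lambda - 1]/(lambda - 1%:R).
  apply: (char_poly_laplacian_corona (K := arcs D1) (D1 := D1)
    (D2 := D2) (E := bwd_arc_corona D1 D2) (d := indeg D1)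
    (p := fun v a => v == (val a).2)
    (q := fun u a => u == (val a).1) (c := 1)
    (N := fun v u => nat_of_bool (D1 u v))) => //.
  + by move=> u [].
  + by case.
  + by case=> [a w] [].
  + exact: card_arcs_in.
  + move=> v u; rewrite -card_arcs_between; apply: eq_card => a.
    by rewrite !inE andbC.
  + by move=> a; rewrite cardsE card1.
(* $Q(G_1)$ is put in the form given by the count of edges containing two given vertices. *)
- have -> : signless_laplacian F (underlying D1) =
      \matrix_(i, j) (deg (underlying D1) (enum_val i)
        * (enum_val i == enum_val j)
        + underlying D1 (enum_val i) (enum_val j))%N%:R.
    apply/matrixP=> i j; rewrite !mxE (inj_eq enum_val_inj) natrD natrM.
    by rewrite mulr_natr.
  apply: (char_poly_laplacian_corona (K := edges (underlying D1)) (D1 := D1)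
    (D2 := D2) (E := sym_arc_corona D1 D2) (d := deg (underlying D1))
    (p := fun u e => u \in val e)
    (q := fun u e => u \in val e) (c := 2)
    (N := fun u v => (deg (underlying D1) u * (u == v)
                      + underlying D1 u v)%N)) => //.
  + by move=> u [].
  + by case.
  + by case=> [a w] [].
  + exact: card_edges_at.
  + exact: card_edges_between.
  + move=> e; rewrite -(card_edge e); apply: eq_card => v.
    by rewrite inE.
Qed.
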